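(* Let $\mathcal{F}$ be the operator ideal of finite rank operators and $\overline{\mathcal{F}}$ the operator ideal of approximable operators. Then $$[\mathcal{F}^{-1}\circ\mathcal{H}_{v\mathcal{F}}^\infty,\|\cdot\|_{\mathcal{F}^{-1}\circ\mathcal{H}_{v\mathcal{F}}^\infty}]=[\mathcal{H}_v^\infty,\|\cdot\|_v]\quad\text{and}\quad[\overline{\mathcal{F}}^{-1}\circ\mathcal{H}_{v\overline{\mathcal{F}}}^\infty,\|\cdot\|_{\overline{\mathcal{F}}^{-1}\circ\mathcal{H}_{v\overline{\mathcal{F}}}^\infty}]=[\mathcal{H}_v^\infty,\|\cdot\|_v].$$ That is, for every open subset $U$ of a complex Banach space, every weight $v$ on $U$, every complex Banach space $F$, every $f\in\mathcal{H}_v^\infty(U,F)$ and $\mathcal{I}\in\{\mathcal{F},\overline{\mathcal{F}}\}$, one has $A\circ f\in\mathcal{H}_{v\mathcal{I}}^\infty(U,G)$ for every complex Banach space $G$ and every $A\in\mathcal{I}(F,G)$, and $\|f\|_{\mathcal{I}^{-1}\circ\mathcal{H}_{v\mathcal{I}}^\infty}=\|f\|_v$.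
   Context: All Banach spaces are complex. A weight $v$ on an open subset $U$ of a Banach space is a strictly positive continuous function on $U$. $\mathcal{H}_v^\infty(U,F)$ is the Banach space of holomorphic $f:U\to F$ with $\|f\|_v:=\sup_{x\in U}v(x)\|f(x)\|<\infty$. Write $(vf)(U)=\{v(x)f(x):x\in U\}$. $\mathcal{F}(F,G)$ is the set of bounded finite rank linear operators, and $\overline{\mathcal{F}}(F,G)$ its operator-norm closure; both carry the operator norm. $\mathcal{H}_{v\mathcal{F}}^\infty(U,F)$ is the set of $f\in\mathcal{H}_v^\infty(U,F)$ such that the linear hull of $(vf)(U)$ is finite dimensional. $\mathcal{H}_{v\overline{\mathcal{F}}}^\infty(U,F)$ is the set of approximable $f\in\mathcal{H}_v^\infty(U,F)$, i.e. those for which there is a sequence $(f_n)$ in $\mathcal{H}_{v\mathcal{F}}^\infty(U,F)$ with $\|f_n-f\|_v\to0$. Both carry the norm $\|\cdot\|_v$. For $\mathcal{I}\in\{\mathcal{F},\overline{\mathcal{F}}\}$, the left-hand quotient $\mathcal{I}^{-1}\circ\mathcal{H}_{v\mathcal{I}}^\infty(U,F)$ is the set of $f\in\mathcal{H}_v^\infty(U,F)$ such that $A\circ f\in\mathcal{H}_{v\mathcal{I}}^\infty(U,G)$ for every Banach space $G$ and every $A\in\mathcal{I}(F,G)$, with norm $\sup\{\|A\circ f\|_v:A\in\mathcal{I}(F,G),\ \|A\|\le1\}$, $G$ ranging over all Banach spaces. *)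

(* Defs.v *)
From HB Require Import structures.
From mathcomp Require Import all_boot all_order all_algebra.
From mathcomp Require Import complex.
From mathcomp Require Import all_classical all_reals all_analysis.

Set Implicit Arguments.
Unset Strict Implicit.
Unset Printing Implicit Defensive.

Import Order.TTheory GRing.Theory Num.Theory.
Import numFieldNormedType.Exports.

Local Open Scope classical_set_scope.
Local Open Scope ring_scope.

(* Functions defined on an open subset U of E are represented by total
   functions on E of which only the values on U matter. *)

Section FiniteDimension.
Context {K : numFieldType} {V : lmodType K}.

Definition linear_hull (S : set V) : set V :=
  [set y | exists n (c : 'I_n -> K) (s : 'I_n -> V),
    (forall i, S (s i)) /\ y = \sum_(i < n) c i *: s i].

Definition finite_dimensional (W : set V) : Prop :=
  exists n (b : 'I_n -> V), W = linear_hull (range b).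

End FiniteDimension.

Section Spaces.
Context {R : realType}.
Implicit Types E F G : completeNormedModType R[i].

(* The library norm of a complex normed space is R[i]-valued (with nonnegative
   real values); rnorm is the same norm, with values in R. *)
Definition rnorm {F} (x : F) : R := complex.Re `|x|.

Definition weight {E} (U : set E) (v : E -> R) : Prop :=
  (forall x, U x -> 0 < v x) /\ {within U, continuous v}.

(* Frechet differentiability over R[i], hence complex differentiability *)
Definition holomorphic {E F} (U : set E) (f : E -> F) : Prop :=
  forall x, U x -> differentiable f x.

(* The extra element 0 only matters when U is empty: there the supremum in
   [0, +oo] is 0, whereas ereal_sup set0 = -oo. *)
Definition wnorm {E F} (U : set E) (v : E -> R) (f : E -> F) : \bar R :=
  ereal_sup (0%E |` [set (v x * rnorm (f x))%:E | x in U]).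

Definition Hv {E} (U : set E) (v : E -> R) F : set (E -> F) :=
  [set f | holomorphic U f /\ (wnorm U v f < +oo)%E].

Definition HvF {E} (U : set E) (v : E -> R) F : set (E -> F) :=
  [set f | Hv U v f /\
    finite_dimensional (linear_hull [set (v x)%:C%C *: f x | x in U])].

Definition HvFbar {E} (U : set E) (v : E -> R) F : set (E -> F) :=
  [set f | Hv U v f /\ exists f_ : nat -> E -> F,
    (forall n, HvF U v (f_ n)) /\
    (fun n => wnorm U v (f_ n \- f)) @ \oo --> 0%E].

Definition opnorm {F G} (A : F -> G) : \bar R :=
  ereal_sup [set (rnorm (A x))%:E | x in [set x | rnorm x <= 1]].

Definition finrank_op F G : set {linear F -> G} :=
  [set A | (opnorm A < +oo)%E /\ finite_dimensional (range A)].

(* operator-norm closure of the finite rank operators in the space of bounded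
   linear operators *)
Definition approx_op F G : set {linear F -> G} :=
  [set A | (opnorm A < +oo)%E /\ forall e : R, 0 < e ->
    exists B : {linear F -> G}, finrank_op B /\ (opnorm (A \- B)%R < e%:E)%E].

Definition lquot {E F} (U : set E) (v : E -> R)
    (I : forall G, set {linear F -> G}) (H : forall G, set (E -> G)) :
    set (E -> F) :=
  [set f | Hv U v f /\
    forall G (A : {linear F -> G}), I G A -> H G (A \o f)].

Definition lquot_norm {E F} (U : set E) (v : E -> R)
    (I : forall G, set {linear F -> G}) (f : E -> F) : \bar R :=
  ereal_sup [set r | exists G (A : {linear F -> G}),
    [/\ I G A, (opnorm A <= 1)%E & r = wnorm U v (A \o f)]].

End Spaces.

(* Main.v *)
(** If [A] is bounded then [|A f| <= |A| |f|] pointwise, so composing with [A]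
    does not increase the weighted norm by more than the factor [|A|]; a finite
    rank [A] keeps the values of [v (A f)] in its finite-dimensional range, and
    for an approximable [A] the compositions with finite rank operators close to
    [A] approximate [A f].  Conversely, by Hahn-Banach every [z] in [F] admits a
    rank one operator [A] on [F] with [|A| <= 1] and [|A z| = |z|]; taking
    [z = f x] for the points [x] of [U] recovers [|f|_v].  Having [F] itself as
    codomain avoids viewing the scalar field as a Banach space. *)

Require Import Defs.
From HB Require Import structures.
From mathcomp Require Import all_boot all_order all_algebra.
From mathcomp Require Import complex ring.
From mathcomp Require Import all_classical all_reals all_analysis.

Set Implicit Arguments.
Unset Strict Implicit.
Unset Printing Implicit Defensive.

Import Order.TTheory GRing.Theory Num.Theory.
Import numFieldNormedType.Exports.
Local Open Scope classical_set_scope.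
Local Open Scope ring_scope.

(** * Linear hulls and finite-dimensional subspaces *)

Section FiniteDimension.
Context {K : numFieldType} {V : lmodType K}.
Implicit Types S W : set V.

Lemma sub_linear_hull S : S `<=` linear_hull S.
Proof.
move=> x Sx; exists 1%N, (fun=> 1), (fun=> x); split=> //.
by rewrite big_ord1 scale1r.
Qed.

Lemma linear_hull0 S : linear_hull S 0.
Proof.
exists 0%N, (fun=> 0), (fun=> 0); split; first by case.
by rewrite big_ord0.
Qed.

Lemma linear_hullZ S a x : linear_hull S x -> linear_hull S (a *: x).
Proof.
move=> [n [c [s [Ss ->]]]]; exists n, (fun i => a * c i), s; split=> //.
by rewrite scaler_sumr; apply: eq_bigr => i _; rewrite scalerA.
Qed.

Lemma linear_hullD S x y :
  linear_hull S x -> linear_hull S y -> linear_hull S (x + y).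
Proof.
move=> [n [c [s [Ss ->]]]] [m [d [t [St ->]]]].
pose glue T (f : 'I_n -> T) (g : 'I_m -> T) (i : 'I_(n + m)) :=
  match fintype.split i with inl j => f j | inr j => g j end.
exists (n + m)%N, (glue _ c d), (glue _ s t); split.
  by move=> i; rewrite /glue; case: splitP.
rewrite big_split_ord; congr (_ + _); apply: eq_bigr => i _.
  by rewrite /glue (unsplitK (inl i : 'I_n + 'I_m)).
by rewrite /glue (unsplitK (inr i : 'I_n + 'I_m)).
Qed.

(** The inclusion of [linear_hull W] in [W] is how being a linear subspace is expressed, here and
    below. *)
Lemma linear_hull_min S W : linear_hull W `<=` W -> S `<=` W ->
  linear_hull S `<=` W.
Proof.
move=> WW SW _ [n [c [s [Ss ->]]]]; apply: WW.
by exists n, c, s; split=> // i; exact: SW.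
Qed.

Lemma linear_hull_idem S : linear_hull (linear_hull S) `<=` linear_hull S.
Proof.
move=> _ [n [c [s [Ss ->]]]]; apply: big_ind => //.
- exact: linear_hull0.
- exact: linear_hullD.
- by move=> i _; exact: linear_hullZ.
Qed.

Lemma linear_hull_range n (b : 'I_n -> V) (c : 'I_n -> K) :
  linear_hull (range b) (\sum_i c i *: b i).
Proof. by exists n, c, b; split=> // i; exists i. Qed.

Lemma finite_dimensional_hull (D : set V) :
  finite_dimensional D -> linear_hull D `<=` D.
Proof. by move=> [n [b ->]]; exact: linear_hull_idem. Qed.

(** A combination in the hull may repeat generators; summing the coefficients that fall on the same
    index leaves one coordinate per [b i]. *)
Lemma linear_hull_rangeP n (b : 'I_n -> V) x :
  linear_hull (range b) x -> exists r : 'rV[K]_n, x = \sum_i r 0 i *: b i.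
Proof.
move=> [m [c [s [bs ->]]]].
have /boolp.choice[f bf] : forall i, exists j, b j = s i.
  by move=> i; have [j _ <-] := bs i; exists j.
exists (\row_i \sum_(j | f j == i) c j).
under [RHS]eq_bigr do rewrite mxE scaler_suml.
rewrite (partition_big f predT) //=; apply: eq_bigr => i _.
by apply: eq_bigr => j /eqP <-; rewrite bf.
Qed.

(* The coordinate vectors of the elements of W form a subspace of 'rV_n, which
   is the row space of a matrix of maximal rank among those whose row space it
   contains. *)
Lemma finite_dimensional_sub (D W : set V) : finite_dimensional D ->
  linear_hull W `<=` W -> W `<=` D -> finite_dimensional W.
Proof.
move=> [n [b ->]] WW Wb.
pose lift (r : 'rV[K]_n) := \sum_i r 0 i *: b i.
have liftD r s : lift (r + s) = lift r + lift s.
  rewrite -big_split; apply: eq_bigr => i _.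
  by rewrite mxE scalerDl.
have liftZ a r : lift (a *: r) = a *: lift r.
  rewrite scaler_sumr; apply: eq_bigr => i _.
  by rewrite mxE scalerA.
have lift0 : lift 0 = 0 by rewrite -[0 in LHS](scale0r 0) liftZ scale0r.
have WD x y : W x -> W y -> W (x + y).
  by move=> Wx Wy; apply: WW; apply: linear_hullD; exact: sub_linear_hull.
have WZ a x : W x -> W (a *: x).
  by move=> Wx; apply: WW; apply: linear_hullZ; exact: sub_linear_hull.
pose inW (M : 'M[K]_n) := forall u, W (lift (u *m M)).
pose Q m := `[< exists2 M, inW M & \rank M = m >].
have exQ : exists m, Q m.
  exists 0%N; apply/asboolP; exists 0; last exact: mxrank0.
  by move=> u; rewrite mulmx0 lift0; apply/WW/linear_hull0.
have ubQ m : Q m -> (m <= n)%N.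
  by move=> /asboolP[M _ <-]; exact: rank_leq_row.
case: (ex_maxnP exQ ubQ) => m /asboolP[M WM <-] maxM.
(* The rows of [M] may be dependent: [finite_dimensional] asks for a spanning family, not for a
   basis. *)
exists n, (fun i => lift (row i M)); apply/seteqP; split; last first.
  apply: linear_hull_min => // _ [i _ <-].
  by rewrite rowE; exact: WM.
move=> x Wx; have [r xr] := linear_hull_rangeP (Wb _ Wx).
(* Adjoining [r] to the row space of [M] stays inside [W], so by maximality the rank does not grow
   and [r] is already in that row space. *)
have WMr : inW (M + r)%MS.
  move=> u; have /sub_addsmxP[[w1 w2] ->] := submxMl u (M + r)%MS.
  rewrite liftD; apply: WD; first exact: WM.
  by rewrite [w2]mx11_scalar mul_scalar_mx liftZ; apply: WZ; rewrite -/(lift r) in xr *; rewrite -xr.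
have rkMr : (\rank (M + r)%MS <= \rank M)%N.
  by apply: maxM; apply/asboolP; exists (M + r)%MS.
have /submxP[u ru] : (r <= M)%MS.
  apply: submx_trans (addsmxSr M r) _.
  by rewrite -(geq_leqif (mxrank_leqif_sup (addsmxSl M r))).
rewrite xr -/(lift r) ru mulmx_sum_row.
rewrite (_ : lift _ = \sum_i u 0 i *: lift (row i M)).
  exact: linear_hull_range.
rewrite (big_morph lift liftD lift0).
by apply: eq_bigr => i _; exact: liftZ.
Qed.

End FiniteDimension.

(** * Hahn-Banach for sublinear functionals on real vector spaces *)

Section HahnBanach.
Context {R : realType} {V : lmodType R}.
Implicit Types p q : V -> R.

(** Homogeneity is only an inequality, which passes easily to infima; [sublinearZ] recovers the
    equality. *)
Definition sublinear p :=
  (forall x y, p (x + y) <= p x + p y) /\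
  (forall t x, 0 <= t -> p (t *: x) <= t * p x).

Lemma sublinear0 p : sublinear p -> p 0 = 0.
Proof.
move=> [pD pZ]; apply/eqP; rewrite eq_le; apply/andP; split.
  by have := pZ 0 0 (lexx 0); rewrite scale0r mul0r.
by have := pD 0 0; rewrite addr0 lerDl.
Qed.

Lemma sublinearZ p t x : sublinear p -> 0 <= t -> p (t *: x) = t * p x.
Proof.
move=> sp; rewrite le_eqVlt => /predU1P[<-|t0].
  by rewrite scale0r mul0r sublinear0.
apply/eqP; rewrite eq_le (sp.2 _ _ (ltW t0)) /=.
rewrite -ler_pdivlMl // -[in leLHS](scalerK (lt0r_neq0 t0) x).
by rewrite sp.2 // invr_ge0 ltW.
Qed.

Lemma sublinear_geN p x : sublinear p -> - p (- x) <= p x.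
Proof.
by move=> sp; rewrite lerNl -subr_ge0 opprK addrC -(sublinear0 sp)
  -(subrr x) sp.1.
Qed.

(** Serves both for tilts and for chains in Zorn's lemma. The single [f i] need not be sublinear:
    the inequalities may pass to another index [k], such as the parameter [s + t] for tilts. *)
Lemma sublinear_inf (I : Type) (D : set I) (f : I -> V -> R) :
  D !=set0 ->
  (forall x, has_lbound [set f i x | i in D]) ->
  (forall i j, D i -> D j ->
    exists2 k, D k & forall x y, f k (x + y) <= f i x + f j y) ->
  (forall i t, D i -> 0 <= t ->
    exists2 k, D k & forall x, f k (t *: x) <= t * f i x) ->
  sublinear (fun x => inf [set f i x | i in D]).
Proof.
move=> [i0 Di0] lbf fD fZ.
have infle i x : D i -> inf [set f i x | i in D] <= f i x.
  by move=> Di; apply: ge_inf => //; exists i.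
have leinf c x : (forall i, D i -> c <= f i x) -> c <= inf [set f i x | i in D].
  move=> H; apply: lb_le_inf; first by exists (f i0 x), i0.
  by move=> _ [i Di <-]; exact: H.
split=> [x y|t x].
  rewrite -lerBlDr; apply: (leinf _ _) => i Di.
  rewrite lerBlDl -lerBlDr; apply: (leinf _ _) => j Dj.
  have [k Dk kD] := fD i j Di Dj.
  by rewrite lerBlDl (le_trans (infle k _ Dk)).
rewrite le_eqVlt => /predU1P[<-|t0].
  have [k Dk kZ] := fZ i0 0 Di0 (lexx 0).
  by rewrite mul0r (le_trans (infle k _ Dk)) // (le_trans (kZ x)) // mul0r.
rewrite -ler_pdivrMl //; apply: (leinf _ _) => i Di.
have [k Dk kZ] := fZ i t Di (ltW t0).
by rewrite ler_pdivrMl // (le_trans (infle k _ Dk)).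
Qed.

(** For sublinear [p], this is the largest sublinear functional below [p] whose value at [- y] is at
    most [- p y]. *)
Definition tilt p (y x : V) : R :=
  inf [set p (x + t *: y) - t * p y | t in [set t : R | 0 <= t]].

Lemma tilt_lbound p y x : sublinear p ->
  has_lbound [set p (x + t *: y) - t * p y | t in [set t : R | 0 <= t]].
Proof.
move=> sp; exists (- p (- x)) => _ [t t0 <-].
rewrite lerBrDl lerBlDr -(sublinearZ y sp t0).
by have := sp.1 (x + t *: y) (- x); rewrite addrAC subrr add0r.
Qed.

Lemma tilt_le p y x : sublinear p -> tilt p y x <= p x.
Proof.
move=> sp; apply: ge_inf; first exact: tilt_lbound.
by exists 0; rewrite /= ?lexx // scale0r addr0 mul0r subr0.
Qed.

Lemma tiltN p y : sublinear p -> tilt p y (- y) <= - p y.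
Proof.
move=> sp; apply: ge_inf; first exact: tilt_lbound.
exists 1; first exact: ler01.
by rewrite scale1r addNr mul1r sublinear0 // sub0r.
Qed.

Lemma sublinear_tilt p y : sublinear p -> sublinear (tilt p y).
Proof.
move=> sp; apply: sublinear_inf.
- by exists 0; exact: lexx.
- by move=> x; exact: tilt_lbound.
- move=> s t /= s0 t0; exists (s + t); first exact: addr_ge0.
  move=> x z; rewrite scalerDl addrACA mulrDl opprD [leRHS]addrACA.
  by rewrite lerD2r sp.1.
- move=> s t /= s0 t0; exists (t * s); first exact: mulr_ge0.
  by move=> x; rewrite -scalerA -scalerDr sublinearZ // mulrBr mulrA.
Qed.

(** Zorn's lemma for the reversed pointwise order. A chain is bounded by its pointwise infimum,
    which is finite because every sublinear [q] below [p] satisfies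
    [- p (- x) <= - q (- x) <= q x]. *)
Lemma sublinear_minorant_minimal p : sublinear p ->
  exists2 q, sublinear q & (forall x, q x <= p x) /\
    forall r, sublinear r -> (forall x, r x <= q x) -> r = q.
Proof.
move=> sp; pose P q := sublinear q /\ forall x, q x <= p x.
pose T := {q | P q}.
pose below (q r : T) := `[< forall x, sval r x <= sval q x >].
have [||||q qmin] := @Zorn T below.
- by move=> q; apply/asboolP.
- move=> q r s /asboolP qr /asboolP rs; apply/asboolP => x.
  exact: le_trans (rs x) (qr x).
- move=> q r /asboolP qr /asboolP rq; apply: eq_sig_hprop => [*|]; first exact: Prop_irrelevance.
  by apply/funext => x; apply/eqP; rewrite eq_le qr rq.
- move=> A totA; have [->|/set0P[q0 Aq0]] := eqVneq A set0.
    (* For the empty chain the infimum would be a mere default value, so [p] itself is the bound. *)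
    by exists (exist P p (conj sp (fun x => lexx (p x)))) => s [].
  have lbA x : has_lbound [set sval q x | q in A].
    exists (- p (- x)) => _ [q Aq <-].
    by rewrite (le_trans _ (sublinear_geN x (svalP q).1)) // lerN2 (svalP q).2.
  have sinf : sublinear (fun x => inf [set sval q x | q in A]).
    apply: sublinear_inf => //; first by exists q0.
      move=> q r Aq Ar; have [/asboolP le|/asboolP le] := totA _ _ Aq Ar.
        exists r => // x y; rewrite (le_trans ((svalP r).1.1 _ _)) //.
        by rewrite lerD2r le.
      exists q => // x y; rewrite (le_trans ((svalP q).1.1 _ _)) //.
      by rewrite lerD2l le.
    by move=> q t Aq t0; exists q => // x; rewrite (svalP q).1.2.
  have infp x : inf [set sval q x | q in A] <= p x.
    apply: le_trans ((svalP q0).2 x).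
    by apply: ge_inf => //; exists q0.
  exists (exist P _ (conj sinf infp)) => q Aq; apply/asboolP => x /=.
  by apply: ge_inf => //; exists q.
exists (sval q); first exact: (svalP q).1.
split=> [|r sr rq]; first exact: (svalP q).2.
have rp x : r x <= p x by exact: le_trans (rq x) ((svalP q).2 x).
have <- // : exist P r (conj sr rp) = q.
by apply: qmin; apply/asboolP.
Qed.

(* A minimal sublinear functional q is linear: q equals its tilts, so that
   q (- y) <= - q y for all y.  Starting from the tilt of p towards x0 forces
   the value at x0. *)
Theorem hahn_banach_sublinear p (x0 : V) : sublinear p ->
  exists f : {linear V -> R^o}, (forall x, f x <= p x) /\ f x0 = p x0.
Proof.
move=> sp; have st := sublinear_tilt x0 sp.
have [q sq [qt qmin]] := sublinear_minorant_minimal st.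
have qp x : q x <= p x by exact: le_trans (qt x) (tilt_le _ _ sp).
have qN x : q (- x) = - q x.
  apply/eqP; rewrite eq_le lerNl sublinear_geN // andbT.
  have := tiltN x sq.
  by rewrite (qmin _ (sublinear_tilt x sq) (fun y => tilt_le _ y sq)).
have qD x y : q (x + y) = q x + q y.
  apply/eqP; rewrite eq_le sq.1 /= -lerN2 opprD -!qN opprD; exact: sq.1.
have qZ t x : q (t *: x) = t * q x.
  have [t0|/ltW t0] := leP 0 t; first exact: sublinearZ.
  by rewrite -[t]opprK scaleNr qN sublinearZ ?oppr_ge0 // !mulNr.
have qlin : linear (q : V -> R^o) by move=> t x y; rewrite qD qZ.
pose qL := GRing.isLinear.Build R V R^o *:%R q qlin.
pose f : {linear V -> R^o} := HB.pack (q : V -> R^o) qL.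
exists f; split=> //; apply/eqP; rewrite eq_le qp /= -lerN2 -qN.
exact: le_trans (qt _) (tiltN _ sp).
Qed.

End HahnBanach.

(** * Restriction of scalars from complex to real *)

(** The alias gives the real module structure a carrier distinct from [V], which keeps its complex
    one. *)
Definition realified {R : rcfType} (V : lmodType R[i]) : Type := V.

Section Realified.
Context {R : rcfType} {V : lmodType R[i]}.

HB.instance Definition _ := GRing.Zmodule.on (realified V).

Let rscale (a : R) (x : realified V) : realified V := a%:C%C *: (x : V).

Let rscaleA a b x : rscale a (rscale b x) = rscale (a * b) x.
Proof. by rewrite /rscale scalerA rmorphM. Qed.

Let rscale1 : left_id 1 rscale.
Proof. by move=> x; rewrite /rscale scale1r. Qed.

Let rscaleDr : right_distributive rscale +%R.
Proof. by move=> a x y; rewrite /rscale scalerDr. Qed.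

Let rscaleDl x : {morph rscale^~ x : a b / a + b}.
Proof. by move=> a b; rewrite /rscale rmorphD scalerDl. Qed.

HB.instance Definition _ := GRing.Zmodule_isLmodule.Build R (realified V)
  rscaleA rscale1 rscaleDr rscaleDl.

Lemma realified_scaleE (a : R) (x : realified V) :
  a *: x = a%:C%C *: (x : V) :> V.
Proof. by []. Qed.

End Realified.

Lemma Re_normK {R : rcfType} (a : R[i]) : (complex.Re `|a|)%:C%C = `|a|.
Proof. exact/RRe_real/normr_real. Qed.

Lemma Re_norm_ge0 {R : rcfType} (a : R[i]) : 0 <= complex.Re `|a|.
Proof. by rewrite -lecR Re_normK; exact: normr_ge0. Qed.

(** * The real-valued norm and norming complex functionals *)

Section Rnorm.
Context {R : realType}.
Implicit Types F G : completeNormedModType R[i].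

Lemma rnormE F (x : F) : `|x| = (rnorm x)%:C%C.
Proof.
exact/esym/RRe_real/normr_real.
Qed.

Lemma rnorm_ge0 F (x : F) : 0 <= rnorm x.
Proof. by rewrite -lecR -rnormE; exact: normr_ge0. Qed.

Lemma rnorm0 F : rnorm (0 : F) = 0.
Proof. by rewrite /rnorm normr0. Qed.

Lemma rnorm_eq0 F (x : F) : (rnorm x == 0) = (x == 0).
Proof. by rewrite -[RHS]normr_eq0 rnormE (fmorph_eq0 (real_complex R)). Qed.

Lemma rnormN F (x : F) : rnorm (- x) = rnorm x.
Proof. by rewrite /rnorm normrN. Qed.

Lemma ler_rnormD F (x y : F) : rnorm (x + y) <= rnorm x + rnorm y.
Proof. by rewrite -lecR rmorphD /= -!rnormE; exact: ler_normD. Qed.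

Lemma rnormZ F (a : R[i]) (x : F) : rnorm (a *: x) = complex.Re `|a| * rnorm x.
Proof.
apply/(@complexI R).
rewrite rmorphM /= -!rnormE normrZ.
congr (_ * _); exact/esym/Re_normK.
Qed.

Lemma sublinear_rnorm F : sublinear (fun x : realified F => rnorm (x : F)).
Proof.
split=> [x y|t x t0]; first exact: ler_rnormD.
by rewrite realified_scaleE rnormZ ger0_norm // ler0c.
Qed.

(* The complex functional with real part f is x |-> f x - i f (i x). *)
Theorem hahn_banach_norm F (x0 : F) : exists f : {linear F -> R[i]^o},
  (forall x, complex.Re `|f x| <= rnorm x) /\ complex.Re `|f x0| = rnorm x0.
Proof.
have [u [ule ux0]] := hahn_banach_sublinear (x0 : realified F) (sublinear_rnorm F).
have uD (x y : F) : u (x + y) = u x + u y by exact: (raddfD u).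
have uZ (s : R) (x : F) : u (s%:C%C *: x) = s * u x.
  exact: (linearZZ u s (x : realified F)).
pose phi (x : F) : R[i]^o := (u x +i* - u ('i%C *: x))%C.
have philin : linear phi.
  move=> [s t] x y; rewrite /phi.
  have -> : (s +i* t)%C = s%:C%C + t%:C%C * 'i%C :> R[i] by simpc.
  rewrite scalerDr scalerDl -scalerA scalerDr !scalerA.
  rewrite ['i%C * _]mulrC.
  rewrite (_ : 'i%C * (t%:C%C * 'i%C) = (- t)%:C%C); last by simpc.
  rewrite -!scalerA !uD !uZ.
  by apply/eqP; rewrite eq_complex /=; apply/andP; split; apply/eqP => /=; ring.
pose phiL := GRing.isLinear.Build R[i] F R[i]^o *:%R phi philin.
pose f : {linear F -> R[i]^o} := HB.pack (phi : F -> R[i]^o) phiL.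
have fle x : complex.Re `|f x| <= rnorm x.
  set m := complex.Re _.
  have mE : `|f x| = m%:C%C by exact/esym/Re_normK.
  have m0 : 0 <= m by exact: Re_norm_ge0.
  have [->|mn0] := eqVneq m 0; first exact: rnorm_ge0.
  (* Multiplying [x] by the conjugate of [f x] makes the value of [f] real, hence equal to that of
     [u]. Then [u <= rnorm] gives [m * m <= m * rnorm x], and [m] cancels. *)
  have fJ : f ((f x)^*%C *: x) = (m * m)%:C%C.
    rewrite linearZ /= [_ *: _]mulrC -sqr_normc mE.
    by rewrite [in RHS]rmorphM.
  have uJ : u ((f x)^*%C *: x) = m * m.
    by have := congr1 (fun z : R[i] => complex.Re z) fJ.
  have m_gt0 : 0 < m by rewrite lt_neqAle eq_sym mn0.
  rewrite -(ler_pM2l m_gt0) -uJ.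
  apply: (le_trans (ule _)); rewrite rnormZ.
  rewrite (_ : complex.Re _ = m) //; congr complex.Re; exact: normcJ.
exists f; split=> //; apply/eqP; rewrite eq_le fle /= -ux0.
rewrite -lecR; have -> : (complex.Re `|f x0|)%:C%C = `|f x0|.
  exact: Re_normK.
by apply: le_trans (normc_ge_Re (f x0)); rewrite lecR; exact: ler_norm.
Qed.

End Rnorm.

(** * Bounded operators and rank one norming operators *)

Section OperatorNorm.
Context {R : realType}.
Implicit Types F G : completeNormedModType R[i].

Lemma opnorm_le F G (A : {linear F -> G}) (M : R) : 0 <= M ->
  (forall x, rnorm (A x) <= M * rnorm x) -> (opnorm A <= M%:E)%E.
Proof.
move=> M0 AM; apply: ge_ereal_sup => _ [x /= x1 <-]; rewrite lee_fin.
by rewrite (le_trans (AM x)) // ler_piMr.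
Qed.

Lemma rnorm_le_opnorm F G (A : {linear F -> G}) (M : R) :
  (opnorm A <= M%:E)%E -> forall x, rnorm (A x) <= M * rnorm x.
Proof.
move=> AM x; have [->|x0] := eqVneq x 0.
  by rewrite linear0 !rnorm0 mulr0.
have nx0 : 0 < rnorm x by rewrite lt_neqAle eq_sym rnorm_eq0 x0 rnorm_ge0.
have normV : complex.Re `|(rnorm x)^-1%:C%C : R[i]| = (rnorm x)^-1.
  by rewrite ger0_norm // ler0c invr_ge0 rnorm_ge0.
have : ((rnorm (A ((rnorm x)^-1%:C%C *: x)))%:E <= M%:E)%E.
  apply: le_trans AM; apply: ereal_sup_ubound; exists ((rnorm x)^-1%:C%C *: x) => //=.
  by rewrite rnormZ normV mulVf // lt0r_neq0.
by rewrite linearZ /= rnormZ normV lee_fin mulrC ler_pdivrMr.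
Qed.

Lemma opnorm_ge0 F G (A : {linear F -> G}) : (0 <= opnorm A)%E.
Proof.
apply: ereal_sup_ubound; exists 0; first by rewrite /= rnorm0 ler01.
by rewrite linear0 rnorm0.
Qed.

Lemma opnorm_fin F G (A : {linear F -> G}) : (opnorm A < +oo)%E ->
  exists2 M : R, 0 <= M & opnorm A = M%:E.
Proof.
move=> Aoo; exists (fine (opnorm A)); first exact/fine_ge0/opnorm_ge0.
by rewrite fineK // ge0_fin_numE // opnorm_ge0.
Qed.

Lemma opnormB F G (A B : {linear F -> G}) : opnorm (A \- B) = opnorm (B \- A).
Proof.
congr ereal_sup; apply: eq_imagel => x _ /=.
by rewrite -[in LHS]rnormN opprB.
Qed.

(** Makes [A \o f] holomorphic: boundedness on balls gives continuity, and a continuous linear map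
    is differentiable. *)
Lemma differentiable_bounded_linear F G (A : {linear F -> G}) x :
  (opnorm A < +oo)%E -> differentiable A x.
Proof.
move=> /opnorm_fin[M M0 AM]; apply: linear_differentiable.
apply/linear_bounded_continuous/bounded_funP => r.
exists (M%:C%C * r) => y yr.
have Ay : rnorm (A y) <= M * rnorm y by apply: rnorm_le_opnorm; rewrite AM.
apply: (@le_trans _ _ (M * rnorm y)%:C%C); first by rewrite rnormE lecR.
by rewrite rmorphM /= -rnormE ler_wpM2l // lecR.
Qed.

Lemma rank_one_norming F (z : F) : exists A : {linear F -> F},
  [/\ finrank_op A, (opnorm A <= 1)%E & rnorm (A z) = rnorm z].
Proof.
have [f [fle fz]] := hahn_banach_norm z.
(* The operator is [x |-> f x *: y]. If [z = 0], the convention that the inverse of 0 is 0 makes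
   [y], and so the operator, zero. *)
pose y := (rnorm z)^-1%:C%C *: z.
have ny : rnorm y = (rnorm z)^-1 * rnorm z.
  by rewrite rnormZ ger0_norm // ler0c invr_ge0 rnorm_ge0.
have ny1 : rnorm y <= 1.
  rewrite ny; have [->|z0] := eqVneq (rnorm z) 0; first by rewrite mulr0 ler01.
  by rewrite mulVf.
pose g (x : F) : F := (f x : R[i]) *: y.
have glin : linear g.
  by move=> a x x'; rewrite /g linearP scalerDl [a *: (_ *: y)]scalerA.
pose gL := GRing.isLinear.Build R[i] F F *:%R g glin.
pose A : {linear F -> F} := HB.pack g gL.
have A1 : (opnorm A <= 1%:E)%E.
  apply: opnorm_le => // x; rewrite mul1r rnormZ.
  apply: le_trans (fle x); rewrite ler_piMr //; exact: Re_norm_ge0.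
exists A; split=> //; last first.
  rewrite rnormZ fz ny; have [->|z0] := eqVneq (rnorm z) 0; first by rewrite mul0r.
  by rewrite mulVf // mulr1.
split; first exact: le_lt_trans A1 (ltry _).
(* Viewing the range as a subspace of the span of [y] also covers the case [y = 0]. *)
apply: (finite_dimensional_sub (D := linear_hull (range (fun _ : 'I_1 => y)))).
- by exists 1%N, (fun=> y).
- move=> _ [n [c [s [/= As ->]]]].
  apply: (big_ind (range A)); first by exists 0; rewrite ?linear0.
    by move=> _ _ [u _ <-] [w _ <-]; exists (u + w); rewrite ?linearD.
  move=> i _; have [u _ <-] := As i; exists (c i *: u) => //; exact: linearZZ.
- by move=> _ [x _ <-]; apply: linear_hullZ; apply: sub_linear_hull; exists ord0.
Qed.

End OperatorNorm.

(** * Weighted norms of compositions and the quotient norms *)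

Section WeightedNorm.
Context {R : realType}.
Implicit Types E F G : completeNormedModType R[i].

Lemma wnorm_ge0 E F (U : set E) (v : E -> R) (f : E -> F) : (0 <= wnorm U v f)%E.
Proof. by apply: ereal_sup_ubound; left. Qed.

Lemma wnorm_ub E F (U : set E) (v : E -> R) (f : E -> F) x : U x ->
  ((v x * rnorm (f x))%:E <= wnorm U v f)%E.
Proof. by move=> Ux; apply: ereal_sup_ubound; right; exists x. Qed.

(** The sign of [M] accounts for the element 0 adjoined to the supremum in [wnorm]. *)
Lemma wnorm_le E F (U : set E) (v : E -> R) (f : E -> F) (M : \bar R) : (0 <= M)%E ->
  (forall x, U x -> ((v x * rnorm (f x))%:E <= M)%E) -> (wnorm U v f <= M)%E.
Proof.
by move=> M0 fM; apply: ge_ereal_sup => _ [->|[x Ux <-]] //; exact: fM.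
Qed.

Lemma wnorm_comp E F G (U : set E) (v : E -> R) (f : E -> F) (A : {linear F -> G}) M :
  (forall x, U x -> 0 < v x) -> 0 <= M -> (opnorm A <= M%:E)%E ->
  (wnorm U v (A \o f) <= M%:E * wnorm U v f)%E.
Proof.
move=> v0 M0 AM; apply: wnorm_le => [|x Ux].
  by apply: mule_ge0; rewrite ?lee_fin // wnorm_ge0.
apply: (@le_trans _ _ (M%:E * (v x * rnorm (f x))%:E)%E); last first.
  by apply: lee_wpmul2l; rewrite ?lee_fin // wnorm_ub.
rewrite -EFinM lee_fin mulrCA ler_pM2l ?v0 //.
exact: rnorm_le_opnorm AM (f x).
Qed.

Lemma Hv_comp E F G (U : set E) (v : E -> R) (f : E -> F) (A : {linear F -> G}) :
  (forall x, U x -> 0 < v x) -> (opnorm A < +oo)%E ->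
  Hv U v f -> Hv U v (A \o f).
Proof.
move=> v0 Aoo [hf foo]; split.
  move=> x Ux; apply: differentiable_comp; first exact: hf.
  exact: differentiable_bounded_linear.
have [M M0 AM] := opnorm_fin Aoo.
apply: (le_lt_trans (wnorm_comp f v0 M0 _)); first by rewrite AM.
by rewrite lte_mul_pinfty.
Qed.

Lemma HvF_comp E F G (U : set E) (v : E -> R) (f : E -> F) (A : {linear F -> G}) :
  (forall x, U x -> 0 < v x) -> finrank_op A ->
  Hv U v f -> HvF U v (A \o f).
Proof.
move=> v0 [Aoo Afin] Hf; split; first exact: Hv_comp.
apply: (finite_dimensional_sub Afin); first exact: linear_hull_idem.
apply: linear_hull_min; first exact: finite_dimensional_hull Afin.
(* By linearity the weight moves inside [A], so the weighted value lies in the range of [A]. *)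
move=> _ [x Ux <-] /=; exists ((v x)%:C%C *: f x) => //; exact: linearZZ.
Qed.

Lemma finrank_approx F G (A : {linear F -> G}) : finrank_op A -> approx_op A.
Proof.
move=> fA; split; first exact: fA.1.
move=> e e0; exists A; split=> //.
apply: (@le_lt_trans _ _ 0%E); last by rewrite lte_fin.
by apply: opnorm_le => // x; rewrite /= subrr rnorm0 mul0r lexx.
Qed.

Lemma HvFbar_comp E F G (U : set E) (v : E -> R) (f : E -> F) (A : {linear F -> G}) :
  (forall x, U x -> 0 < v x) -> approx_op A ->
  Hv U v f -> HvFbar U v (A \o f).
Proof.
move=> v0 [Aoo Aapp] Hf; split; first exact: Hv_comp.
have /boolp.choice[B BA] (n : nat) : exists B : {linear F -> G},
    finrank_op B /\ (opnorm (A \- B)%R < (n.+1%:R^-1)%:E)%E.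
  by apply: Aapp; rewrite invr_gt0 ltr0n.
exists (fun n => B n \o f); split=> [n|].
  exact: HvF_comp (BA n).1 Hf.
(* Finiteness lets the factor [wnorm U v f] pass through the limit of [1 / (n + 1)]. *)
have foo : wnorm U v f \is a fin_num by rewrite ge0_fin_numE ?wnorm_ge0 // Hf.2.
apply: (@squeeze_cvge _ _ _ _ (cst 0%E) _
  (fun n => (n.+1%:R^-1)%:E * wnorm U v f)%E).
- apply: nearW => n; rewrite wnorm_ge0 /=.
  (* The difference of the two compositions is, by computation, [(B n \- A) \o f]. *)
  apply: (wnorm_comp (A := B n \- A) f v0); first by [].
  by rewrite opnormB; exact/ltW/(BA n).2.
- exact: cvg_cst.
- rewrite -(mul0e (wnorm U v f)); apply: cvgeZr => //.
  by apply: cvg_EFin; [exact: nearW|exact: cvg_harmonic].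
Qed.

(** The lower bound uses only finite rank operators from [F] to itself, so one argument covers both
    ideals. *)
Lemma lquot_norm_eq E F (U : set E) (v : E -> R) (I : forall G, set {linear F -> G})
    (f : E -> F) :
  (forall x, U x -> 0 < v x) -> (forall A : {linear F -> F}, finrank_op A -> I F A) ->
  lquot_norm U v I f = wnorm U v f.
Proof.
move=> v0 finI; apply/eqP; rewrite eq_le; apply/andP; split.
  apply: ge_ereal_sup => _ [G [A [_ A1 ->]]].
  by rewrite -[leRHS]mul1e; exact: wnorm_comp.
have lq (A : {linear F -> F}) : finrank_op A -> (opnorm A <= 1)%E ->
    (wnorm U v (A \o f) <= lquot_norm U v I f)%E.
  by move=> fA A1; apply: ereal_sup_ubound; exists F, A; split=> //; exact: finI.
apply: wnorm_le => [|x Ux].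
  (* Any admissible operator shows that the supremum is nonnegative; the one attached to the vector
     0 is at hand even when [U] is empty. *)
  have [A [fA A1 _]] := rank_one_norming (0 : F).
  exact: le_trans (wnorm_ge0 _ _ _) (lq _ fA A1).
have [A [fA A1 <-]] := rank_one_norming (f x).
exact: le_trans (wnorm_ub v (A \o f) Ux) (lq _ fA A1).
Qed.

End WeightedNorm.

Theorem mainTheorem5 (R : realType) (E F : completeNormedModType R[i])
    (U : set E) (v : E -> R) (openU : open U) (wv : weight U v) :
  [/\ lquot U v (@finrank_op R F) (@HvF R E U v) = @Hv R E U v F,
      (forall f : E -> F, Hv U v f ->
        lquot_norm U v (@finrank_op R F) f = wnorm U v f),
      lquot U v (@approx_op R F) (@HvFbar R E U v) = @Hv R E U v F &
      (forall f : E -> F, Hv U v f ->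
        lquot_norm U v (@approx_op R F) f = wnorm U v f)].
Proof.
have v0 := wv.1; split.
- apply/seteqP; split=> [f []//|f Hf]; split=> // G A fA; exact: HvF_comp.
- by move=> f _; exact: lquot_norm_eq.
- apply/seteqP; split=> [f []//|f Hf]; split=> // G A aA; exact: HvFbar_comp.
- by move=> f _; apply: lquot_norm_eq => // A; exact: finrank_approx.
Qed.
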